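(* Let $\mu$ and $\nu$ be Borel probability measures on $\mathbb{R}^d$, both different from the Dirac measure $\delta_0$ at the origin, with finite second moments and mean zero, i.e. $\mu,\nu\in\mathcal{P}_{2,0}\setminus\{\delta_0\}$. Then $\angle(\mu,\nu)=\pi/2$ if and only if the linear subspaces $\mathrm{Span}\langle \mathrm{supp}(\mu)\rangle$ and $\mathrm{Span}\langle \mathrm{supp}(\nu)\rangle$ of $\mathbb{R}^d$ are orthogonal, that is, $\langle x,y\rangle=0$ for all $x\in \mathrm{Span}\langle \mathrm{supp}(\mu)\rangle$ and $y\in\mathrm{Span}\langle \mathrm{supp}(\nu)\rangle$.
   Context: $\mathbb{R}^d$ carries its standard inner product $\langle\cdot,\cdot\rangle$ and norm $|\cdot|$. $\mathcal{P}_2$ is the set of Borel probability measures $\mu$ on $\mathbb{R}^d$ with $\int_{\mathbb{R}^d}|x|^2\,d\mu(x)<\infty$, and $\mathcal{P}_{2,0}$ is the set of $\mu\in\mathcal{P}_2$ with $\int_{\mathbb{R}^d}x\,d\mu(x)=0$. For $\mu,\nu\in\mathcal{P}_2$, $\Pi(\mu,\nu)$ is the set of Borel probability measures on $\mathbb{R}^d\times\mathbb{R}^d$ with first marginal $\mu$ and second marginal $\nu$, and the $L^2$-Wasserstein distance is $$W_2(\mu,\nu)=\sqrt{\inf_{\sigma\in\Pi(\mu,\nu)}\int_{\mathbb{R}^d\times\mathbb{R}^d}|x-y|^2\,d\sigma(x,y)}.$$ For $\mu,\nu\in\mathcal{P}_2\setminus\{\delta_0\}$, the angle at $\delta_0$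 is $$\angle(\mu,\nu)=\arccos\left(\frac{W_2(\delta_0,\mu)^2+W_2(\delta_0,\nu)^2-W_2(\mu,\nu)^2}{2\,W_2(\delta_0,\mu)\,W_2(\delta_0,\nu)}\right).$$ $\mathrm{supp}(\mu)$ is the (topological) support of $\mu$, and $\mathrm{Span}\langle A\rangle$ denotes the linear span of $A\subset\mathbb{R}^d$. *)

(* Defs.v *)
From HB Require Import structures.
From mathcomp Require Import all_boot all_order all_algebra.
From mathcomp Require Import all_classical all_reals all_analysis.
From mathcomp Require Import giry.
Import Order.TTheory GRing.Theory Num.Theory numFieldNormedType.Exports.

Set Implicit Arguments.
Unset Strict Implicit.
Unset Printing Implicit Defensive.

Local Open Scope classical_set_scope.
Local Open Scope ring_scope.

(* R^d with its Borel sigma-algebra.  The topology of 'rV[R]_d is that of the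
   sup norm, which is the Euclidean one; the library's `|x| is the sup norm,
   so the Euclidean norm is defined separately. *)
Notation borel R d := (g_sigma_algebraType (@open 'rV[R]_d)).

Section defs.
Context {R : realType} {d : nat}.
Implicit Types (mu nu : probability (borel R d) R) (x y : 'rV[R]_d).

Definition inner x y : R := \sum_(i < d) x 0 i * y 0 i.

Definition enorm x : R := Num.sqrt (inner x x).

Definition finite_second_moment mu :=
  (\int[mu]_(x in setT) (enorm x ^+ 2)%:E < +oo)%E.

(* Meaningful only when the coordinates are mu-integrable, which holds under
   [finite_second_moment mu]. *)
Definition mean mu : 'rV[R]_d :=
  \row_(i < d) Rintegral mu setT (fun x : 'rV[R]_d => x 0 i).

Definition P2 : set (probability (borel R d) R) :=
  [set mu | finite_second_moment mu].

Definition P20 : set (probability (borel R d) R) :=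
  [set mu | P2 mu /\ mean mu = 0].

Definition delta0 : probability (borel R d) R :=
  @dirac _ (borel R d) (0 : 'rV[R]_d) R.

(* A coupling is a probability on the product sigma-algebra, which is the Borel
   sigma-algebra of the product space by [measurable_prod_borelE]. *)
Definition coupling mu nu : set (probability (borel R d * borel R d)%type R) :=
  [set s | forall A : set (borel R d), measurable A ->
     pushforward s fst A = mu A /\ pushforward s snd A = nu A].

(* The infimum is finite when mu and nu have finite second moments; otherwise
   [fine] may return a junk value. *)
Definition W2 mu nu : R :=
  Num.sqrt (fine (ereal_inf
    [set (\int[s]_(z in setT) (enorm (z.1 - z.2) ^+ 2)%:E)%E
       | s in coupling mu nu])).

Definition angle mu nu : R :=
  acos ((W2 delta0 mu ^+ 2 + W2 delta0 nu ^+ 2 - W2 mu nu ^+ 2)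
        / (2 * W2 delta0 mu * W2 delta0 nu)).

Definition supp mu : set 'rV[R]_d :=
  [set x | forall U : set 'rV[R]_d, open U -> U x -> (0 < mu U)%E].

Definition Span (A : set 'rV[R]_d) : set 'rV[R]_d :=
  [set v | exists2 X : seq 'rV[R]_d, [set` X] `<=` A & v \in <<X>>%VS].

End defs.
Arguments P2 {R d}.
Arguments P20 {R d}.
Arguments delta0 {R d}.

Section product_borel.
Context {R : realType} {d : nat}.
Local Notation V := 'rV[R]_d.
Local Notation K := ('rV[rat]_d * nat)%type.

Let B (k : K) : set V := ball (map_mx ratr k.1 : V) k.2.+1%:R^-1.

Let openB k : open (B k).
Proof. by apply: ball_open; rewrite invr_gt0. Qed.

Let basisB (x : V) (U : set V) : nbhs x U -> exists k, B k x /\ B k `<=` U.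
Proof.
move=> /nbhs_ballP[e /= e0 eU].
have [n ne] : exists n, n.+1%:R^-1 < e / 2.
  have e20 : 0 < e / 2 by rewrite divr_gt0.
  exists (Num.truncn (e / 2)^-1).
  by rewrite -[ltRHS]invrK ltf_pV2 ?posrE ?invr_gt0// truncnS_gt.
have Hq (i : 'I_d) : exists q : rat, ball (ratr q : R) n.+1%:R^-1 (x 0 i).
  have n0 : x 0 i < x 0 i + n.+1%:R^-1 by rewrite ltrDl invr_gt0.
  have [q] := rat_in_itvoo n0; rewrite in_itv/= => /andP[xq qx].
  exists q; rewrite /ball/= ger0_norm ?subr_ge0 ?(ltW xq)//.
  by rewrite ltrBlDl.
have [q qP] := choice Hq.
exists (\row_i q i, n); split => [|y].
  by split; [rewrite invr_gt0|move=> i j; rewrite (ord1 i) !mxE].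
move=> ky; apply: eU; rewrite (splitr e).
apply: (@ball_triangle _ _ (map_mx ratr (\row_i q i) : V)).
  apply: ball_sym; apply: (le_ball (ltW ne)).
  by split; [rewrite invr_gt0|move=> i j; rewrite (ord1 i) !mxE].
exact: (le_ball (ltW ne)).
Qed.

Lemma measurable_prod_borelE :
  @measurable _ (borel R d * borel R d)%type = <<s @open (V * V)%type >>.
Proof.
rewrite eqEsubset; split.
  apply: smallest_sub; first exact: smallest_sigma_algebra.
  rewrite subUset; split.
    have H : <<s @open V >> `<=` [set A | <<s @open (V * V)%type >> (fst @^-1` A)].
      apply: smallest_sub.
        split => /=.
        - by rewrite preimage_set0; exact: sigma_algebra0.
        - by move=> A sA; rewrite setTD preimage_setC -setTD; exact: sigma_algebraCD.
        - by move=> F sF; rewrite preimage_bigcup; exact: sigma_algebra_bigcup.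
      move=> A oA /=; apply: sub_sigma_algebra.
      by apply: open_comp => // z _; exact: cvg_fst.
    by move=> _ [A mA <-]; rewrite setTI; exact: H.
  have H : <<s @open V >> `<=` [set A | <<s @open (V * V)%type >> (snd @^-1` A)].
    apply: smallest_sub.
      split => /=.
      - by rewrite preimage_set0; exact: sigma_algebra0.
      - by move=> A sA; rewrite setTD preimage_setC -setTD; exact: sigma_algebraCD.
      - by move=> F sF; rewrite preimage_bigcup; exact: sigma_algebra_bigcup.
    move=> A oA /=; apply: sub_sigma_algebra.
    by apply: open_comp => // z _; exact: cvg_snd.
  by move=> _ [A mA <-]; rewrite setTI; exact: H.
apply: smallest_sub; first exact: sigma_algebra_measurable.
move=> W oW.
have -> : W = \bigcup_(k : K * K)
    if `[< B k.1 `*` B k.2 `<=` W >] then B k.1 `*` B k.2 else set0.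
  rewrite eqEsubset; split => [[x y] Wxy|z [k _]]; last first.
    by case: asboolP => // + ?; exact.
  have : nbhs (x, y) W by exact: open_nbhs_nbhs.
  move=> [[P Q] /= [xP yQ] PQW].
  have [k1 [k1x k1P]] := basisB xP.
  have [k2 [k2y k2Q]] := basisB yQ.
  exists (k1, k2) => //=; case: asboolP => // -[].
  by move=> [u v] [/= /k1P Pu /k2Q Qv]; exact: PQW.
apply: (@countable_bigcupT_measurable _ (borel R d * borel R d)%type).
  exact: countableP.
move=> k; case: asboolP => _; last exact: measurable0.
by apply: measurableX; apply: sub_sigma_algebra; exact: openB.
Qed.

End product_borel.

(* Main.v *)
From HB Require Import structures.
Require Import Defs.
From mathcomp Require Import all_boot all_order all_algebra.
From mathcomp Require Import all_classical all_reals all_analysis.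
From mathcomp Require Import giry measurable_realfun ring lra.
Import Order.TTheory GRing.Theory Num.Theory numFieldNormedType.Exports.

Set Implicit Arguments.
Unset Strict Implicit.
Unset Printing Implicit Defensive.

Local Open Scope classical_set_scope.
Local Open Scope ring_scope.

(* Let M and N be the second moments of mu and nu, both nonzero.  The angle is
   pi / 2 iff W2(mu, nu)^2 = M + N.  A coupling s has cost
   M + N - 2 \int <x, y> ds, which is M + N when the supports are orthogonal,
   since mu and nu are concentrated on their supports.  Conversely, if
   W2(mu, nu)^2 = M + N, perturb the product coupling: for centered f, g with
   values in [-1, 1], (1 + f(x) g(y)) d(mu x nu) is a coupling.  Taking
   f = s (1_A - mu A) with s = 1 or -1, and g = 1_B - nu B, its cost is
   M + N - 2 s \int_(A x B) <x, y> d(mu x nu), because the means vanish.  Hence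
   \int_(A x B) <x, y> d(mu x nu) = 0 for all Borel sets A, B, and shrinking
   A x B to a point of supp mu x supp nu gives the orthogonality. *)

(** * Probability measures defined by a density *)

Section density.
Context d (T : measurableType d) (R : realType) (P : probability T R).
Local Open Scope ereal_scope.

(* By uniqueness, w is the Radon-Nikodym derivative of S, whence the change of
   variables. *)
Lemma probability_density (w : T -> R) : measurable_fun setT w ->
  (forall x, (0 <= w x)%R) -> \int[P]_x (w x)%:E = 1 ->
  exists S : probability T R,
    (forall A, measurable A -> S A = \int[P]_(x in A) (w x)%:E) /\
    (forall h : T -> \bar R, measurable_fun setT h -> (forall x, 0 <= h x) ->
      \int[S]_x h x = \int[P]_x (h x * (w x)%:E)).
Proof.
move=> mw w0 w1.
have mEw : measurable_fun setT (EFin \o w) by exact/measurable_EFinP.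
have Ew0 x : 0 <= (EFin \o w) x by rewrite lee_fin.
pose m A := \int[P]_(x in A) (EFin \o w) x.
have m0 : m set0 = 0 by rewrite /m integral_set0.
have mge A : 0 <= m A by exact: integral_ge0.
have msig : semi_sigma_additive m by exact: semi_sigma_additive_nng_induced.
pose M : {measure set T -> \bar R} :=
  HB.pack m (isMeasure.Build _ _ _ m m0 mge msig).
pose S : probability T R :=
  HB.pack m M (Measure_isProbability.Build _ _ _ M w1).
have SE A : S A = \int[P]_(x in A) (w x)%:E by [].
exists S; split => // h mh h0.
have SP : S `<< P.
  apply/null_content_dominatesP => A mA PA0.
  rewrite SE; apply: null_set_integral => //; exact: measurable_funTS.
rewrite -(Radon_Nikodym_SigmaFinite.change_of_variables SP)//.
apply: ae_eq_integral => //.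
- apply: emeasurable_funM => //.
  exact: measurable_int (Radon_Nikodym_SigmaFinite.f_integrable SP).
- exact: emeasurable_funM.
have : ae_eq P setT (Radon_Nikodym_SigmaFinite.f S P) (EFin \o w).
  apply: integral_ae_eq => //.
    exact: Radon_Nikodym_SigmaFinite.f_integrable.
  by move=> E _ mE; rewrite -Radon_Nikodym_SigmaFinite.f_integral.
by apply: filterS => x /= /(_ I) ->.
Qed.
End density.

(** * Integrals of [u x * v y] against a product measure *)

Section product.
Context d1 d2 (T1 : measurableType d1) (T2 : measurableType d2) (R : realType).
Context (mu : probability T1 R) (nu : probability T2 R).
Context (u : T1 -> R) (v : T2 -> R).
Context (iu : mu.-integrable setT (EFin \o u)).
Context (iv : nu.-integrable setT (EFin \o v)).

Let mu_ : measurable_fun setT u.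
Proof. by apply/measurable_EFinP; exact: measurable_int iu. Qed.
Let mv_ : measurable_fun setT v.
Proof. by apply/measurable_EFinP; exact: measurable_int iv. Qed.

(** By Tonelli, the iterated integral of [|u x * v y|] factors into the integrals of [|u|] and
    [|v|], both finite. *)
Lemma integrable_prod :
  (mu \x nu)%E.-integrable setT (EFin \o (fun z => u z.1 * v z.2)).
Proof.
have muv : measurable_fun setT (EFin \o (fun z : T1 * T2 => u z.1 * v z.2)).
  apply/measurable_EFinP; apply: measurable_funM.
    exact: (measurableT_comp mu_ measurable_fst).
  exact: (measurableT_comp mv_ measurable_snd).
apply/integrable12ltyP => //=.
under eq_integral => x _.
  under eq_integral do rewrite normrM EFinM.
  rewrite ge0_integralZl_EFin//; last first.
    by apply/measurable_EFinP; exact: measurableT_comp.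
  over.
have [_ fu] := integrableP _ _ _ iu; have [mv' fv] := integrableP _ _ _ iv.
rewrite ge0_integralZr//=.
- by rewrite lte_mul_pinfty// ?ge0_fin_numE ?integral_ge0.
- by apply/measurable_EFinP; exact: measurableT_comp.
- exact: integral_ge0.
Qed.

Lemma Rintegral_prod :
  \int[(mu \x nu)%E]_z (u z.1 * v z.2) = \int[mu]_x u x * \int[nu]_y v y.
Proof.
rewrite /Rintegral -integral12_prod_meas1; last exact: integrable_prod.
rewrite /fubini_F/=.
under eq_integral => x _.
  under eq_integral do rewrite EFinM.
  rewrite integralZl//=.
  rewrite -[X in (_ * X)%E]fineK; last exact: integrable_fin_num.
  over.
rewrite integralZr//= fineM//.
exact: integrable_fin_num.
Qed.
End product.

(** * A calculus of integrable functions with known integral *)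

Section has_integral.
Context d (T : measurableType d) (R : realType) (P : {measure set T -> \bar R}).
Implicit Types (h : T -> R) (a b c : R).

Definition has_integral h c :=
  P.-integrable setT (EFin \o h) /\ \int[P]_x h x = c.

Lemma has_integralT h :
  P.-integrable setT (EFin \o h) -> has_integral h (\int[P]_x h x).
Proof. by split. Qed.

Lemma has_integral_EFin h c : has_integral h c -> (\int[P]_x (h x)%:E = c%:E)%E.
Proof. by move=> [ih <-]; rewrite fineK//; exact: integrable_fin_num. Qed.

Lemma has_integralD h1 h2 a b : has_integral h1 a -> has_integral h2 b ->
  has_integral (fun x => h1 x + h2 x) (a + b).
Proof.
move=> [ih1 <-] [ih2 <-]; split; last by rewrite RintegralD.
exact: (integrableD measurableT ih1 ih2).
Qed.

Lemma has_integralZ h a k : has_integral h a ->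
  has_integral (fun x => k * h x) (k * a).
Proof.
move=> [ih <-]; split; last by rewrite RintegralZl.
exact: (integrableZl measurableT k ih).
Qed.

Lemma has_integral_sum n (h : 'I_n -> T -> R) (a : 'I_n -> R) :
  (forall i, has_integral (h i) (a i)) ->
  has_integral (fun x => \sum_(i < n) h i x) (\sum_(i < n) a i).
Proof.
move=> ha; elim: n h a ha => [|n ih] h a ha.
  under [X in has_integral X]eq_fun do rewrite big_ord0.
  rewrite big_ord0; split; first exact: integrable0.
  by rewrite /Rintegral integral0.
under [X in has_integral X]eq_fun do rewrite big_ord_recl.
by rewrite big_ord_recl; apply: has_integralD => //; exact: ih.
Qed.

Lemma integrableM_le1 h (f : T -> R) : measurable_fun setT f ->
  (forall x, `|f x| <= 1) -> P.-integrable setT (EFin \o h) ->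
  P.-integrable setT (EFin \o (fun x => h x * f x)).
Proof.
move=> mf f1 ih; apply: (le_integrable _ _ _ ih) => //.
  apply/measurable_EFinP; apply: measurable_funM => //.
  by apply/measurable_EFinP; exact: measurable_int ih.
by move=> x _ /=; rewrite lee_fin normrM ler_piMr.
Qed.

End has_integral.

Lemma has_integral_prod d1 d2 (T1 : measurableType d1) (T2 : measurableType d2)
    (R : realType) (mu : probability T1 R) (nu : probability T2 R)
    (u : T1 -> R) (v : T2 -> R) (a b : R) :
  has_integral mu u a -> has_integral nu v b ->
  has_integral (mu \x nu)%E (fun z => u z.1 * v z.2) (a * b).
Proof.
move=> [iu <-] [iv <-]; split; first exact: integrable_prod.
exact: Rintegral_prod.
Qed.

(** * Measurability and moments on R^d *)

Section borel.
Context {R : realType} {d : nat}.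
Implicit Types (mu nu : probability (borel R d) R) (x y : 'rV[R]_d).

Lemma open_measurable_borel (A : set 'rV[R]_d) :
  open A -> measurable (A : set (borel R d)).
Proof. by move=> oA; exact: sub_sigma_algebra. Qed.

Lemma measurable_coord (i : 'I_d) :
  measurable_fun setT (fun x : borel R d => (x : 'rV[R]_d) 0 i).
Proof.
apply: (measurability _ (RGenOpens.measurableE R)).
move=> _ [_ [a [b ->] <-]]; rewrite setTI; apply: open_measurable_borel.
by apply: open_comp; [move=> x _; exact: coord_continuous|exact: interval_open].
Qed.

Lemma sqr_enorm x : enorm x ^+ 2 = \sum_(i < d) x 0 i ^+ 2.
Proof.
rewrite sqr_sqrtr; first by apply: eq_bigr => i _; rewrite expr2.
by apply: sumr_ge0 => i _; rewrite -expr2 sqr_ge0.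
Qed.

Lemma measurable_sqr_enorm :
  measurable_fun setT (fun x : borel R d => enorm (x : 'rV[R]_d) ^+ 2).
Proof.
under eq_fun do rewrite sqr_enorm.
apply: measurable_sum => i; apply: measurable_funX; exact: measurable_coord.
Qed.

Lemma measurable_cost : measurable_fun setT
  (fun z : borel R d * borel R d => enorm ((z.1 : 'rV[R]_d) - z.2) ^+ 2).
Proof.
under eq_fun do rewrite sqr_enorm.
apply: measurable_sum => i; apply: measurable_funX.
under eq_fun do rewrite !mxE.
apply: measurable_funB.
  exact: (measurableT_comp (measurable_coord i) measurable_fst).
exact: (measurableT_comp (measurable_coord i) measurable_snd).
Qed.

Definition second_moment mu : R := \int[mu]_x (enorm (x : 'rV[R]_d) ^+ 2).

Lemma has_integral_sqr_enorm mu : P2 mu ->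
  has_integral mu (fun x => enorm (x : 'rV[R]_d) ^+ 2) (second_moment mu).
Proof.
move=> mu2; split => //; apply/integrableP; split.
  apply/measurable_EFinP; exact: measurable_sqr_enorm.
by under eq_integral do rewrite gee0_abs ?lee_fin ?sqr_ge0//.
Qed.

Lemma second_moment_EFin mu : P2 mu ->
  (\int[mu]_x (enorm (x : 'rV[R]_d) ^+ 2)%:E = (second_moment mu)%:E)%E.
Proof. by move=> /has_integral_sqr_enorm/has_integral_EFin. Qed.

Lemma integrable_coord mu (i : 'I_d) : P2 mu ->
  mu.-integrable setT (EFin \o (fun x => (x : 'rV[R]_d) 0 i)).
Proof.
move=> /has_integral_sqr_enorm[imu _].
have i1 : mu.-integrable setT (EFin \o cst (1 : R)).
  exact: finite_measure_integrable_cst.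
apply: (le_integrable _ _ _ (integrableD measurableT i1 imu)) => //.
  apply/measurable_EFinP; exact: measurable_coord.
move=> x _; rewrite lee_fin /= [leRHS]ger0_norm ?addr_ge0 ?sqr_ge0//.
have xE : x 0 i ^+ 2 <= enorm x ^+ 2.
  rewrite sqr_enorm (bigD1 i)//= lerDl; apply: sumr_ge0 => j _; exact: sqr_ge0.
(* Expanding the square gives [2|t| <= 1 + t^2], so the coordinate is dominated by the integrable
   function [1 + |x|^2]. *)
have := sqr_ge0 (`|x 0 i| - 1).
rewrite sqrrB mulr1 expr1n real_normK ?num_real//.
have := normr_ge0 (x 0 i).
by lra.
Qed.

End borel.

(** * Perturbations of the product measure that keep its marginals *)

Lemma has_integral_cst d (T : measurableType d) (R : realType)
    (P : probability T R) (c : R) : has_integral P (cst c) c.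
Proof.
split; first exact: finite_measure_integrable_cst.
by rewrite Rintegral_cst//= probability_setT mulr1.
Qed.

Lemma has_integral_indic d (T : measurableType d) (R : realType)
    (P : probability T R) (A : set T) : measurable A ->
  has_integral P (\1_A : T -> R) (fine (P A)).
Proof.
move=> mA; split; first exact: integrable_indic.
by rewrite /Rintegral integral_indic// setIT.
Qed.

(** The density [1 + f x * g y] is nonnegative because both factors are bounded by 1. Integrating
    out either variable leaves 1, since [f] and [g] have mean zero; hence the marginals are
    unchanged. The last clause reduces integrals against [S] to the product measure. *)
Lemma perturbed_product d1 d2 (T1 : measurableType d1) (T2 : measurableType d2)
    (R : realType) (mu : probability T1 R) (nu : probability T2 R)
    (f : T1 -> R) (g : T2 -> R) :
  measurable_fun setT f -> measurable_fun setT g ->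
  (forall x, `|f x| <= 1) -> (forall y, `|g y| <= 1) ->
  has_integral mu f 0 -> has_integral nu g 0 ->
  exists S : probability (T1 * T2)%type R,
    [/\ forall A, measurable A -> S (fst @^-1` A) = mu A,
        forall B, measurable B -> S (snd @^-1` B) = nu B &
        forall (h : T1 * T2 -> R) c, measurable_fun setT h ->
          (forall z, 0 <= h z) ->
          has_integral (mu \x nu)%E (fun z => h z * (1 + f z.1 * g z.2)) c ->
          (\int[S]_z (h z)%:E = c%:E)%E].
Proof.
move=> mf mg f1 g1 f0 g0.
pose w (z : T1 * T2) := 1 + f z.1 * g z.2.
have mw : measurable_fun setT w.
  apply: measurable_funD => //; apply: measurable_funM.
    exact: (measurableT_comp mf measurable_fst).
  exact: (measurableT_comp mg measurable_snd).
have w0 z : 0 <= w z.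
  have := f1 z.1; have := g1 z.2.
  rewrite /w !ler_norml => /andP[? ?] /andP[? ?].
  nra.
have cw : (\int[(mu \x nu)%E]_z (w z)%:E = 1)%E.
  apply: has_integral_EFin.
  rewrite [X in has_integral _ _ X](_ : _ = 1 * 1 + 0 * 0); last by lra.
  apply: has_integralD; last exact: has_integral_prod.
  under eq_fun do rewrite -[1]mulr1.
  exact: (has_integral_prod (has_integral_cst mu 1) (has_integral_cst nu 1)).
have [S [SE Sint]] := probability_density mw w0 cw.
have Sh (h : T1 * T2 -> R) c : measurable_fun setT h ->
    (forall z, 0 <= h z) ->
    has_integral (mu \x nu)%E (fun z => h z * w z) c ->
    (\int[S]_z (h z)%:E = c%:E)%E.
  move=> mh h0 hc; rewrite Sint.
  - exact: has_integral_EFin hc.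
  - exact/measurable_EFinP.
  - by move=> z; rewrite lee_fin.
exists S; split => //.
- move=> A mA.
  have mA' : measurable (fst @^-1` A : set (T1 * T2)).
    by rewrite -[X in measurable X]setTI; exact: measurable_fst.
  rewrite -[LHS]fineK ?fin_num_measure// -[RHS]fineK ?fin_num_measure//.
  rewrite -[in LHS](setIT (fst @^-1` A)) -integral_indic//.
  rewrite (@Sh _ (fine (mu A)))//.
  (* The final factor 0 is the integral of [g]: the perturbation does not change the mass of a
     cylinder over [A]. *)
  rewrite [X in has_integral _ _ X](_ : _ =
    fine (mu A) * 1 + \int[mu]_x (\1_A x * f x) * 0); last by lra.
  have -> : (fun z => \1_(fst @^-1` A) z * w z) =
      (fun z => \1_A z.1 * cst 1 z.2 + (\1_A z.1 * f z.1) * g z.2).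
    by apply/funext => z; rewrite /w mulrDr mulrA.
  have iA := has_integral_indic mu mA.
  apply: has_integralD.
    exact: (has_integral_prod iA (has_integral_cst nu 1)).
  have iAf : has_integral mu (fun x => \1_A x * f x)
      (\int[mu]_x (\1_A x * f x)).
    by apply: has_integralT; apply: integrableM_le1 => //; case: iA.
  exact: (has_integral_prod iAf g0).
- move=> A mA.
  have mA' : measurable (snd @^-1` A : set (T1 * T2)).
    by rewrite -[X in measurable X]setTI; exact: measurable_snd.
  rewrite -[LHS]fineK ?fin_num_measure// -[RHS]fineK ?fin_num_measure//.
  rewrite -[in LHS](setIT (snd @^-1` A)) -integral_indic//.
  rewrite (@Sh _ (fine (nu A)))//.
  rewrite [X in has_integral _ _ X](_ : _ =
    1 * fine (nu A) + 0 * \int[nu]_x (\1_A x * g x)); last by lra.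
  have -> : (fun z => \1_(snd @^-1` A) z * w z) =
      (fun z => cst 1 z.1 * \1_A z.2 + f z.1 * (\1_A z.2 * g z.2)).
    by apply/funext => z; rewrite /w mulrDr mulrCA [_ * 1]mulrC.
  have iA := has_integral_indic nu mA.
  apply: has_integralD.
    exact: (has_integral_prod (has_integral_cst mu 1) iA).
  have iAg : has_integral nu (fun x => \1_A x * g x)
      (\int[nu]_x (\1_A x * g x)).
    by apply: has_integralT; apply: integrableM_le1 => //; case: iA.
  exact: (has_integral_prod f0 iAg).
Qed.

(** * Transport cost of the perturbed couplings *)

Section coupling.
Context {R : realType} {d : nat}.
Implicit Types (mu nu : probability (borel R d) R).
Local Notation V := 'rV[R]_d.

Lemma sqr_enormB (x y : V) : enorm (x - y) ^+ 2 =
  enorm x ^+ 2 + (enorm y ^+ 2 + (- 2) * inner x y).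
Proof.
rewrite !sqr_enorm /inner mulr_sumr -!big_split/=; apply: eq_bigr => i _.
by rewrite !mxE; ring.
Qed.

Lemma has_integral_coord mu (i : 'I_d) : P20 mu ->
  has_integral mu (fun x => (x : V) 0 i) 0.
Proof.
move=> [mu2 m0]; split; first exact: integrable_coord.
by move/rowP : m0 => /(_ i); rewrite !mxE.
Qed.

(** Expand the cost as [|x|^2 + |y|^2 - 2 <x, y>] and multiply by the density. The perturbation of
    the square terms integrates to 0 because [f] and [g] are centered, and the unperturbed inner
    product does because the means of [mu] and [nu] vanish. Only the perturbed inner product
    remains. *)
Lemma perturbed_coupling mu nu (f g : borel R d -> R) : P20 mu -> P20 nu ->
  measurable_fun setT f -> measurable_fun setT g ->
  (forall x, `|f x| <= 1) -> (forall y, `|g y| <= 1) ->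
  has_integral mu f 0 -> has_integral nu g 0 ->
  exists2 S : probability (borel R d * borel R d)%type R, coupling mu nu S &
    (\int[S]_z (enorm ((z.1 : V) - z.2) ^+ 2)%:E =
     (second_moment mu + second_moment nu
      - 2 * \sum_(i < d) (\int[mu]_x ((x : V) 0 i * f x)
                          * \int[nu]_y ((y : V) 0 i * g y)))%:E)%E.
Proof.
move=> mu0 nu0 mf mg f1 g1 f0 g0.
have [S [Sfst Ssnd Sint]] := perturbed_product mf mg f1 g1 f0 g0.
exists S; first by move=> A mA; split; [exact: Sfst|exact: Ssnd].
apply: Sint; first exact: measurable_cost.
  by move=> z; rewrite sqr_ge0.
have [mu2 nu2] := (mu0.1, nu0.1).
have qmu := has_integral_sqr_enorm mu2; have qnu := has_integral_sqr_enorm nu2.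
have iM (m : probability (borel R d) R) (h k : borel R d -> R) :
    measurable_fun setT k ->
    (forall x, `|k x| <= 1) -> m.-integrable setT (EFin \o h) ->
    has_integral m (fun x => h x * k x) (\int[m]_x (h x * k x)).
  by move=> mk k1 ih; apply: has_integralT; exact: integrableM_le1.
pose E (x : V) := enorm x ^+ 2.
(* Every summand becomes a function of [z.1] times a function of [z.2], with [cst 1] as a filler, as
   [has_integral_prod] requires. *)
have -> : (fun z : borel R d * borel R d =>
    enorm ((z.1 : V) - z.2) ^+ 2 * (1 + f z.1 * g z.2)) =
  (fun z => (E z.1 * cst 1 z.2 + (E z.1 * f z.1) * g z.2) +
     ((cst 1 z.1 * E z.2 + f z.1 * (E z.2 * g z.2)) +
     (- 2) * \sum_(i < d) (((z.1 : V) 0 i * (z.2 : V) 0 i) +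
              ((z.1 : V) 0 i * f z.1) * ((z.2 : V) 0 i * g z.2)))).
  apply/funext => z; rewrite sqr_enormB big_split/=.
  have -> : \sum_(i < d) ((z.1 : V) 0 i * f z.1) * ((z.2 : V) 0 i * g z.2) =
      inner (z.1 : V) z.2 * (f z.1 * g z.2).
    by rewrite /inner mulr_suml; apply: eq_bigr => i _; rewrite mulrACA.
  rewrite -/(inner (z.1 : V) z.2) /E /=; ring.
rewrite [X in has_integral _ _ X](_ : _ =
  (second_moment mu * 1 + \int[mu]_x (E x * f x) * 0) +
  ((1 * second_moment nu + 0 * \int[nu]_x (E x * g x)) +
   (-2) * \sum_(i < d) (0 * 0 + \int[mu]_x ((x : V) 0 i * f x)
                          * \int[nu]_y ((y : V) 0 i * g y)))); last first.
  rewrite big_split/= [X in _ * (X + _)]big1; last by move=> i _; rewrite mulr0.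
  by lra.
apply: has_integralD.
  apply: has_integralD.
    exact: (has_integral_prod qmu (has_integral_cst nu 1)).
  exact: (has_integral_prod (iM mu _ f mf f1 qmu.1) g0).
apply: has_integralD.
  apply: has_integralD.
    exact: (has_integral_prod (has_integral_cst mu 1) qnu).
  exact: (has_integral_prod f0 (iM nu _ g mg g1 qnu.1)).
apply: has_integralZ; apply: has_integral_sum => i; apply: has_integralD.
  exact: (has_integral_prod (has_integral_coord i mu0)
    (has_integral_coord i nu0)).
apply: (has_integral_prod (iM mu _ f mf f1 (integrable_coord i mu2))
  (iM nu _ g mg g1 (integrable_coord i nu2))).
Qed.

End coupling.

(* Outside [-1, 1], [acos] takes the default value of R, which is 0. *)
Lemma acos_eq_pihalf (R : realType) (t : R) : acos t = pi / 2 <-> t = 0.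
Proof.
split=> [|->]; last exact: acos0.
rewrite acos.unlock.
have [[y yP]|/forallNP noy] := pselect (exists y, 0 <= y <= pi /\ cos y = t).
  case: (getPex (ex_intro _ y yP : [set y | 0 <= y <= pi /\ cos y = t] !=set0)).
  by move=> _ ct tp; rewrite -ct tp cos_pihalf.
rewrite getPN//.
have := pi_gt0 R; rewrite /point/= => p0 pE.
by move: p0; lra.
Qed.

(** * Supports, and the Dirac measure at the origin *)

Section support.
Context {R : realType} {d : nat}.
Implicit Types (mu nu : probability (borel R d) R).
Local Notation V := 'rV[R]_d.

(** Open boxes with rational corners: a base of the topology whose index type is countable. *)
Let box (q : 'rV[rat]_d * 'rV[rat]_d) : set (borel R d) :=
  \bigcap_(i in [set: 'I_d])
    ((fun x : V => x 0 i) @^-1` `]ratr (q.1 0 i), ratr (q.2 0 i)[%classic).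

Let measurable_box q : measurable (box q).
Proof.
apply: fin_bigcap_measurable => // i _.
by rewrite -[X in measurable X]setTI; exact: measurable_coord.
Qed.

Let box_nbhs (x : V) (U : set V) : nbhs x U ->
  exists2 q, box q x & box q `<=` U.
Proof.
move=> /nbhs_ballP[e /= e0 eU].
have lo (i : 'I_d) : exists q : rat, ratr q \in `]x 0 i - e, x 0 i[.
  by apply: rat_in_itvoo; rewrite gtrBl.
have hi (i : 'I_d) : exists q : rat, ratr q \in `]x 0 i, x 0 i + e[.
  by apply: rat_in_itvoo; rewrite ltrDl.
have [q qP] := choice lo; have [r rP] := choice hi.
exists (\row_i q i, \row_i r i) => [i _|y yP].
  have := qP i; have := rP i.
  by rewrite /= !mxE !in_itv/= => /andP[-> _] /andP[_ ->].
apply: eU; split => // i j; rewrite (ord1 i) /ball/= ltr_norml.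
have := yP j I; have := qP j; have := rP j; rewrite /= !mxE !in_itv/=.
by move=> /andP[? ?] /andP[? ?] /andP[? ?]; apply/andP; split; lra.
Qed.

(** A point outside the support has a null open neighborhood, hence lies in a null rational box, and
    there are only countably many of these. *)
Lemma negligible_setC_supp mu : mu.-negligible (~` supp mu : set (borel R d)).
Proof.
(* A sequence listing the null boxes; codes of other boxes, and numbers that code nothing, yield the
   empty set. *)
pose F n : set (borel R d) :=
  if unpickle n is Some q then
    if mu (box q) == 0%E then box q else set0 else set0.
have F0 n : mu.-negligible (F n).
  rewrite /F; case: (unpickle n) => [q|]; last exact: negligible_set0.
  case: eqP => [q0|_]; last exact: negligible_set0.
  by exists (box q); split => //; exact: measurable_box.
apply: negligibleS (negligible_bigcup F0) => x.
move=> /existsNP[U] /not_implyP[oU] /not_implyP[Ux].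
move=> /negP; rewrite -leNgt => U0.
have [q qx qU] := box_nbhs (open_nbhs_nbhs (conj oU Ux)).
have q0 : mu (box q) = 0%E.
  apply/eqP; rewrite -measure_le0 (le_trans _ U0)//.
  apply: le_measure => //; rewrite inE//.
  exact: open_measurable_borel.
by exists (pickle q) => //; rewrite /F pickleK q0 eqxx.
Qed.

Lemma delta0E (A : set (borel R d)) : delta0 A = ((0 : V) \in A)%:R%:E.
Proof. exact: diracE. Qed.

Lemma supp_delta0 (x : V) : supp delta0 x -> x = 0.
Proof.
move=> sx; apply/eqP/negP => /negP x0.
have oU : open (~` [set 0] : set V).
  apply: closed_openC; apply: accessible_closed_set1.
  exact: (hausdorff_accessible (@norm_hausdorff _ _)).
have := sx _ oU (fun xE : x = 0 => negP x0 (introT eqP xE)).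
have x0E : ((0 : V) \in ~` [set (0 : V)]) = false by apply: memNset; exact.
by rewrite delta0E x0E lte_fin mulr0n ltxx.
Qed.

Lemma P2_delta0 : P2 (@delta0 R d).
Proof.
rewrite /P2/= /finite_second_moment integral_dirac//.
  by rewrite diracT mul1e ltry.
apply/measurable_EFinP; exact: measurable_sqr_enorm.
Qed.

Lemma second_moment_delta0 : second_moment (@delta0 R d) = 0.
Proof.
rewrite /second_moment /Rintegral integral_dirac//; last first.
  apply/measurable_EFinP; exact: measurable_sqr_enorm.
by rewrite diracT mul1e /= sqr_enorm big1// => i _; rewrite mxE expr0n.
Qed.

Lemma second_moment_eq0 mu : P2 mu -> second_moment mu = 0 ->
  measure_eq mu delta0.
Proof.
move=> mu2 m0.
have me : measurable_fun setT (fun x : borel R d => (enorm (x : V) ^+ 2)%:E).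
  apply/measurable_EFinP; exact: measurable_sqr_enorm.
have := second_moment_EFin mu2; rewrite m0 => e0.
have : ae_eq mu setT (fun x : borel R d => (enorm (x : V) ^+ 2)%:E) (cst 0%E).
  apply/(ae_eq_integral_abs mu measurableT me).
  by under eq_integral do rewrite gee0_abs ?lee_fin ?sqr_ge0//.
move=> ae0.
have neg : mu.-negligible (~` [set (0 : V)] : set (borel R d)).
  apply: negligibleS ae0 => x /= xn0 /(_ I) [] /eqP.
  rewrite sqr_enorm psumr_eq0; last by move=> *; exact: sqr_ge0.
  move=> /allP x0; apply: xn0; apply/rowP => i; rewrite mxE; apply/eqP.
  by have := x0 i; rewrite mem_index_enum sqrf_eq0 => /(_ isT).
have [N [mN N0 sN]] := neg.
(* Since [|x|^2] vanishes almost everywhere, sets missing the origin are null. Applied to a set or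
   to its complement, this determines [mu] everywhere. *)
have null (A : set (borel R d)) : measurable A -> ~ A (0 : V) -> mu A = 0%E.
  move=> mA A0; apply/eqP; rewrite -measure_le0 -N0.
  apply: le_measure; rewrite ?inE// => x Ax; apply: sN => /= xE.
  by apply: A0; rewrite -xE.
move=> A mA; rewrite [RHS]delta0E.
have [A0|A0] := pselect (A (0 : V)); last first.
  by rewrite memNset//; exact: null.
have AC0 : mu (~` A) = 0%E by apply: null; [exact: measurableC|exact].
have := probability_setC mu (measurableC mA).
by rewrite setCK AC0 sube0 mem_set.
Qed.

End support.

(** * The Wasserstein distance when the supports are orthogonal *)

Section wasserstein.
Context {R : realType} {d : nat}.
Implicit Types (mu nu : probability (borel R d) R).
Local Notation V := 'rV[R]_d.

Let costs mu nu : set (\bar R) :=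
  [set (\int[s]_(z in setT) (enorm ((z.1 : V) - z.2) ^+ 2)%:E)%E
     | s in coupling mu nu].

Let costs_ge0 mu nu : (0 <= ereal_inf (costs mu nu))%E.
Proof.
apply: le_ereal_inf_tmp => _ [S _ <-]; apply: integral_ge0 => z _.
by rewrite lee_fin sqr_ge0.
Qed.

Let W2E mu nu : W2 mu nu ^+ 2 = fine (ereal_inf (costs mu nu)).
Proof. by rewrite sqr_sqrtr//; apply: fine_ge0; exact: costs_ge0. Qed.

Lemma sqr_W2_le mu nu (S : probability (borel R d * borel R d)%type R) c :
  coupling mu nu S ->
  (\int[S]_z (enorm ((z.1 : V) - z.2) ^+ 2)%:E = c%:E)%E ->
  W2 mu nu ^+ 2 <= c.
Proof.
(* One finite cost makes the infimum finite, so [fine] returns its true value. *)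
move=> cS Sc; have infc : (ereal_inf (costs mu nu) <= c%:E)%E.
  by apply: ereal_inf_lbound; exists S.
rewrite W2E -lee_fin fineK//.
by rewrite ge0_fin_numE ?costs_ge0// (le_lt_trans infc)// ltry.
Qed.

(** The perturbation with [f = g = 0]. It is needed so that the infimum in [W2] is not taken over
    the empty set. *)
Lemma product_coupling mu nu : exists S, coupling mu nu S.
Proof.
have c0 (m : probability (borel R d) R) : has_integral m (cst (0 : R)) 0.
  exact: has_integral_cst.
have n0 (x : borel R d) : `|cst (0 : R) x| <= 1 by rewrite normr0 ler01.
have mc : measurable_fun setT (cst (0 : R) : borel R d -> R).
  exact: measurable_cst.
have [S [S1 S2 _]] := perturbed_product mc mc n0 n0 (c0 mu) (c0 nu).
by exists S => A mA; split; [exact: S1|exact: S2].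
Qed.

Lemma integral_coupling_fst mu nu S (h : borel R d -> \bar R) :
  coupling mu nu S -> measurable_fun setT h -> (forall x, (0 <= h x)%E) ->
  (\int[S]_z h z.1 = \int[mu]_x h x)%E.
Proof.
move=> cS mh h0.
rewrite -(ge0_integral_pushforward measurable_fst S measurableT mh
  (fun y _ => h0 y) : _ = \int[S]_z h z.1)%E.
by apply: eq_measure_integral => A mA _; have [] := cS A mA.
Qed.

Lemma integral_coupling_snd mu nu S (h : borel R d -> \bar R) :
  coupling mu nu S -> measurable_fun setT h -> (forall x, (0 <= h x)%E) ->
  (\int[S]_z h z.2 = \int[nu]_x h x)%E.
Proof.
move=> cS mh h0.
rewrite -(ge0_integral_pushforward measurable_snd S measurableT mh
  (fun y _ => h0 y) : _ = \int[S]_z h z.2)%E.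
by apply: eq_measure_integral => A mA _; have [] := cS A mA.
Qed.

Lemma cost_orthogonal mu nu S : P2 mu -> P2 nu -> coupling mu nu S ->
  (forall x y, supp mu x -> supp nu y -> inner x y = 0) ->
  (\int[S]_z (enorm ((z.1 : V) - z.2) ^+ 2)%:E =
     (second_moment mu + second_moment nu)%:E)%E.
Proof.
move=> mu2 nu2 cS orth.
have me : measurable_fun setT (fun x : borel R d => (enorm (x : V) ^+ 2)%:E).
  by apply/measurable_EFinP; exact: measurable_sqr_enorm.
have e0 (x : borel R d) : (0 <= (enorm (x : V) ^+ 2)%:E)%E.
  by rewrite lee_fin sqr_ge0.
rewrite EFinD -(second_moment_EFin mu2) -(second_moment_EFin nu2).
rewrite -(integral_coupling_fst cS me e0) -(integral_coupling_snd cS me e0).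
have me1 := measurableT_comp me (@measurable_fst _ _ (borel R d) (borel R d)).
have me2 := measurableT_comp me (@measurable_snd _ _ (borel R d) (borel R d)).
rewrite -ge0_integralD//.
apply: ge0_ae_eq_integral => //.
- by apply/measurable_EFinP; exact: measurable_cost.
- exact: emeasurable_funD.
- by move=> z _; exact: adde_ge0.
(* Null sets of the marginals pull back to null sets of [S]. Off them both components lie in the
   supports, where the inner product is 0 and the two integrands agree. *)
have [A [mA A0 sA]] := negligible_setC_supp mu.
have [B [mB B0 sB]] := negligible_setC_supp nu.
have nA : S.-negligible (fst @^-1` A).
  exists (fst @^-1` A); split => //;
    last by have [SA _] := cS A mA; exact: etrans SA A0.
  by rewrite -[X in measurable X]setTI; exact: measurable_fst.
have nB : S.-negligible (snd @^-1` B).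
  exists (snd @^-1` B); split => //;
    last by have [_ SB] := cS B mB; exact: etrans SB B0.
  by rewrite -[X in measurable X]setTI; exact: measurable_snd.
apply: negligibleS (negligibleU nA nB) => z /= zP.
apply: contrapT => /not_orP[zA zB]; apply: zP => _.
have x1 : supp mu z.1 by apply: contrapT => /sA.
have x2 : supp nu z.2 by apply: contrapT => /sB.
by rewrite -EFinD sqr_enormB orth// mulr0 addr0.
Qed.

Lemma sqr_W2_orthogonal mu nu : P2 mu -> P2 nu ->
  (forall x y, supp mu x -> supp nu y -> inner x y = 0) ->
  W2 mu nu ^+ 2 = second_moment mu + second_moment nu.
Proof.
move=> mu2 nu2 orth; rewrite W2E.
(* All couplings have the same cost, so the infimum is over a singleton. *)
have -> : costs mu nu = [set (second_moment mu + second_moment nu)%:E].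
  apply/seteqP; split => [_ [S cS <-]|_ ->]; first exact: cost_orthogonal.
  have [S cS] := product_coupling mu nu.
  by exists S => //; exact: cost_orthogonal.
by rewrite ereal_inf1.
Qed.

(** A special case of orthogonal supports: that of [delta0] contains no point but the origin. *)
Lemma sqr_W2_delta0 mu : P2 mu -> W2 delta0 mu ^+ 2 = second_moment mu.
Proof.
move=> mu2; rewrite (sqr_W2_orthogonal P2_delta0 mu2).
  by rewrite second_moment_delta0 add0r.
move=> x y /supp_delta0 -> _; rewrite /inner big1// => i _.
by rewrite mxE mul0r.
Qed.

(** * From the value of the distance back to orthogonal supports *)

Lemma centered_indic mu (A : set (borel R d)) (s : R) :
  measurable A -> `|s| <= 1 ->
  let f x := s * (\1_A x - fine (mu A)) in
  [/\ measurable_fun setT f, forall x, `|f x| <= 1 & has_integral mu f 0].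
Proof.
move=> mA s1 f.
have p0 : 0 <= fine (mu A) by exact: fine_ge0.
have p1 : fine (mu A) <= 1.
  by rewrite -lee_fin fineK ?fin_num_measure// probability_le1.
split.
- apply: measurable_funM => //; apply: measurable_funB => //.
- move=> x; rewrite normrM mulr_ile1//.
  by rewrite ler_norml /indic; case: (x \in A) => /=; apply/andP; split; lra.
- have -> : f = fun x => s * (\1_A x + cst (- fine (mu A)) x) by [].
  have -> : 0 = s * (fine (mu A) + - fine (mu A)) by rewrite subrr mulr0.
  apply: has_integralZ; apply: has_integralD; last exact: has_integral_cst.
  exact: has_integral_indic.
Qed.

Lemma has_integral_coord_indic mu (A : set (borel R d)) (i : 'I_d) :
  P20 mu -> measurable A ->
  has_integral mu (fun x => (x : V) 0 i * \1_A x)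
    (\int[mu]_x ((x : V) 0 i * \1_A x)).
Proof.
move=> mu0 mA; apply: has_integralT; apply: integrableM_le1 => //.
  by move=> x; rewrite /indic; case: (_ \in A); rewrite ?normr1 ?normr0 ?ler01.
by apply: integrable_coord; exact: mu0.1.
Qed.

(** The centering term contributes a multiple of the mean, which is zero. *)
Lemma has_integral_coord_centered_indic mu (A : set (borel R d)) (s : R)
    (i : 'I_d) :
  P20 mu -> measurable A ->
  has_integral mu (fun x => (x : V) 0 i * (s * (\1_A x - fine (mu A))))
    (s * \int[mu]_x ((x : V) 0 i * \1_A x)).
Proof.
move=> mu0 mA.
have -> : (fun x : borel R d => (x : V) 0 i * (s * (\1_A x - fine (mu A)))) =
  (fun x => s * ((x : V) 0 i * \1_A x + (- fine (mu A)) * (x : V) 0 i)).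
  by apply/funext => x; ring.
apply: has_integralZ; rewrite -[X in has_integral _ _ X]addr0.
rewrite -[X in _ + X](mulr0 (- fine (mu A))).
apply: has_integralD; first exact: has_integral_coord_indic.
by apply: has_integralZ; exact: has_integral_coord.
Qed.

Lemma rectangle_inner_eq0 mu nu (A B : set (borel R d)) : P20 mu -> P20 nu ->
  measurable A -> measurable B ->
  W2 mu nu ^+ 2 = second_moment mu + second_moment nu ->
  has_integral (mu \x nu)%E
    (fun z => inner (z.1 : V) z.2 * (\1_A z.1 * \1_B z.2)) 0.
Proof.
move=> mu0 nu0 mA mB W2mn.
pose a i := \int[mu]_x ((x : V) 0 i * \1_A x).
pose b i := \int[nu]_x ((x : V) 0 i * \1_B x).
(* The perturbed coupling costs at least [W2 mu nu ^+ 2], which equals the sum of the second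
   moments; comparing leaves this sign condition. Taking [s] to be 1 and -1 then forces the sum to
   vanish. *)
have le_s (s : R) : `|s| <= 1 -> s * \sum_(i < d) a i * b i <= 0.
  move=> s1.
  have [mf f1 f0] := centered_indic mu mA s1.
  have n1 : `|1 : R| <= 1 by rewrite normr1.
  have [mg g1 g0] := centered_indic nu mB n1.
  have [S cS Sc] := perturbed_coupling mu0 nu0 mf mg f1 g1 f0 g0.
  have := sqr_W2_le cS Sc; rewrite W2mn.
  under eq_bigr => i _ do rewrite
     (has_integral_coord_centered_indic s i mu0 mA).2
     (has_integral_coord_centered_indic 1 i nu0 mB).2 mul1r -mulrA.
  by rewrite -mulr_sumr; lra.
have ab0 : \sum_(i < d) a i * b i = 0.
  have := le_s 1; have := le_s (-1).
  rewrite normrN normr1 => /(_ (lexx _)) + /(_ (lexx _)).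
  by lra.
have -> : (fun z : borel R d * borel R d =>
    inner (z.1 : V) z.2 * (\1_A z.1 * \1_B z.2)) =
  (fun z => \sum_(i < d) ((z.1 : V) 0 i * \1_A z.1) *
                        ((z.2 : V) 0 i * \1_B z.2)).
  apply/funext => z; rewrite /inner mulr_suml; apply: eq_bigr => i _.
  by rewrite mulrACA.
rewrite -[X in has_integral _ _ X]ab0; apply: has_integral_sum => i.
exact: (has_integral_prod (has_integral_coord_indic i mu0 mA)
  (has_integral_coord_indic i nu0 mB)).
Qed.

Lemma continuous_inner : continuous (fun z : V * V => inner z.1 z.2).
Proof.
move=> z; rewrite /inner; apply: cvg_big => [|i _]; first exact: add_continuous.
apply: cvgM.
  apply: (@cvg_comp _ _ _ fst (fun x : V => x 0 i) _ _ _ cvg_fst).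
  exact: coord_continuous.
  apply: (@cvg_comp _ _ _ snd (fun x : V => x 0 i) _ _ _ cvg_snd).
  exact: coord_continuous.
Qed.

Lemma supp_orthogonal mu nu : P20 mu -> P20 nu ->
  W2 mu nu ^+ 2 = second_moment mu + second_moment nu ->
  forall x y : V, supp mu x -> supp nu y -> inner x y = 0.
Proof.
move=> mu0 nu0 W2mn x y sx sy; apply/eqP/negP => /negP c0.
set c := inner x y in c0.
(* Multiplying the inner product by [c], its value at [(x, y)], treats both signs of [c] at once: by
   continuity the product stays above [c * c / 2] nearby. *)
have c2 : 0 < c * c / 2 by rewrite divr_gt0// -expr2 exprn_even_gt0.
have : nbhs (x, y) [set z : V * V | c * c / 2 < c * inner z.1 z.2].
  have cvgc : c * inner z.1 z.2 @[z --> (x, y)] --> c * c.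
    by apply: cvgM; [exact: cvg_cst|exact: (@continuous_inner (x, y))].
  by apply: (cvgr_gt _ cvgc); lra.
move=> [[A B] /= [xA yB] sAB].
(* [A] and [B] are merely neighborhoods; their interiors are open and contain [x] and [y], so they
   are measurable and of positive mass by the definition of [supp]. *)
have [oA oB] := (@open_interior _ A, @open_interior _ B).
have mA := open_measurable_borel oA; have mB := open_measurable_borel oB.
have pA : 0 < fine (mu A°).
  by rewrite fine_gt0// sx//= -ge0_fin_numE// fin_num_measure.
have pB : 0 < fine (nu B°).
  by rewrite fine_gt0// sy//= -ge0_fin_numE// fin_num_measure.
have hI := has_integralZ c (rectangle_inner_eq0 mu0 nu0 mA mB W2mn).
have hJ := has_integralZ (c * c / 2)
  (has_integral_prod (has_integral_indic mu mA) (has_integral_indic nu mB)).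
(* Integrate the lower bound over the rectangle of the interiors: a positive number would be at most
   0. *)
have : c * c / 2 * (fine (mu A°) * fine (nu B°)) <= c * 0.
  rewrite -hI.2 -hJ.2; apply: le_Rintegral => //; [exact: hJ.1|exact: hI.1|].
  move=> z _; rewrite mulrA /indic.
  have [zA|zA] := boolP (z.1 \in (A° : set V));
    last by rewrite mulr0n !mul0r !mulr0.
  have [zB|zB] := boolP (z.2 \in (B° : set V));
    last by rewrite mulr0n !mulr0.
  rewrite !mulr1n !mulr1; apply/ltW; apply: (sAB z).
  by split; apply: interior_subset; exact: set_mem.
rewrite mulr0 leNgt => /negP; apply.
by apply: mulr_gt0 => //; exact: mulr_gt0.
Qed.

(** * From supports to their spans, and the angle *)

Lemma inner_span (x : V) (X : seq V) (y : V) :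
  (forall v, v \in X -> inner v y = 0) -> x \in <<X>>%VS -> inner x y = 0.
Proof.
move=> Xy xX; rewrite (@coord_span _ _ _ (in_tuple X) x xX) /inner.
under eq_bigr => i _ do rewrite summxE mulr_suml.
rewrite exchange_big/= big1// => j _.
have := Xy (X`_j) (mem_nth _ (ltn_ord j)); rewrite /inner => Xj.
under eq_bigr => i _ do rewrite mxE -mulrA.
by rewrite -mulr_sumr Xj mulr0.
Qed.

Lemma innerC (x y : V) : inner x y = inner y x.
Proof. by apply: eq_bigr => i _; rewrite mulrC. Qed.

Lemma subset_Span (A : set V) : A `<=` Span A.
Proof.
move=> x Ax; exists [:: x]; last by rewrite memv_span// mem_head.
by move=> v /=; rewrite inE => /eqP ->.
Qed.

Lemma Span_orthogonal (A B : set V) :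
  (forall x y, Span A x -> Span B y -> inner x y = 0) <->
  (forall x y, A x -> B y -> inner x y = 0).
Proof.
split=> [H x y Ax By|H x y [X XA xX] [Y YB yY]].
  by apply: H; exact: subset_Span.
apply: inner_span xX => v vX; rewrite innerC; apply: inner_span yY => w wY.
by rewrite innerC H//; [exact: XA|exact: YB].
Qed.

End wasserstein.

Theorem theorem1 (R : realType) (d : nat) (mu nu : probability (borel R d) R)
  (mu_P20 : P20 mu) (nu_P20 : P20 nu)
  (mu_neq : ~ measure_eq mu delta0) (nu_neq : ~ measure_eq nu delta0) :
  angle mu nu = pi / 2 <->
  (forall x y : 'rV[R]_d,
    Span (supp mu) x -> Span (supp nu) y -> inner x y = 0).
Proof.
have [mu2 nu2] := (mu_P20.1, nu_P20.1).
(* The denominator in [angle] must be nonzero: division by 0 yields 0, which would make the angle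
   [pi / 2]. *)
have W0 (m : probability (borel R d) R) : P2 m -> ~ measure_eq m delta0 ->
    W2 delta0 m != 0.
  move=> m2 mneq; apply/eqP => W20; apply: mneq; apply: second_moment_eq0 => //.
  by rewrite -sqr_W2_delta0// W20 expr0n.
rewrite Span_orthogonal /angle acos_eq_pihalf !sqr_W2_delta0//.
(* With a nonzero denominator, the argument of [acos] vanishes exactly when this Pythagorean
   identity holds. *)
transitivity (W2 mu nu ^+ 2 = second_moment mu + second_moment nu).
  split=> [/eqP|->]; last by rewrite subrr mul0r.
  rewrite mulf_eq0 invr_eq0 !mulf_eq0 pnatr_eq0/= !(negPf (W0 _ _ _))// !orbF.
  by rewrite subr_eq0 eq_sym => /eqP.
by split; [exact: supp_orthogonal|exact: sqr_W2_orthogonal].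
Qed.
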